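(* Let $q,a,b$ be nonzero complex numbers with $|q|<1$ and $\max\{|ab|,|aq^2|,|bq^2|\}<1$. Then $$\frac{(q^2,ab;q^2)_\infty}{(aq^2,bq^2;q^2)_\infty}\;{}_3\phi_2\left(\begin{matrix}q^2/a,\,q^2/b,\,-q\\ q,\,-q^2\end{matrix};q^2,ab\right)=\sum_{n=0}^\infty\sum_{j=-n}^n(1-q^{4n+2})\frac{(q^2/a,q^2/b;q^2)_n}{(aq^2,bq^2;q^2)_n}(ab)^nq^{2n^2-j^2}.$$
   Context: Notation, for a base $p$ with $|p|<1$: $(x;p)_0=1$, $(x;p)_n=\prod_{k=0}^{n-1}(1-xp^k)$, $(x;p)_\infty=\prod_{k=0}^\infty(1-xp^k)$, $(x_1,\dots,x_k;p)_n=(x_1;p)_n\cdots(x_k;p)_n$ (also for $n=\infty$), and $${}_3\phi_2\left(\begin{matrix}A_1,A_2,A_3\\ B_1,B_2\end{matrix};p,z\right)=\sum_{n=0}^\infty\frac{(A_1,A_2,A_3;p)_n}{(p,B_1,B_2;p)_n}z^n .$$ *)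

(* Defs.v *)
From Stdlib Require Import Reals Lra ZArith Lia.
From Coquelicot Require Import Coquelicot.

Open Scope C_scope.

(* Coquelicot's [Series] is real-valued only.  This is the complex sum of [u],
   meaningful when [ex_series u] holds. *)
Definition CSeries (u : nat -> C) : C :=
  iota (T := C_CompleteNormedModule) (fun l => is_series u l).

Fixpoint qpoch (x p : C) (n : nat) : C :=
  match n with
  | O => 1
  | S k => qpoch x p k * (1 - x * p ^ k)
  end.

(* The limit exists whenever |p| < 1: see [qpoch_inf_correct]. *)
Definition qpoch_inf (x p : C) : C :=
  iota (T := C_CompleteNormedModule) (fun l => filterlim (qpoch x p) eventually (locally l)).

Definition phi32_term (A1 A2 A3 B1 B2 p z : C) (n : nat) : C :=
  (qpoch A1 p n * qpoch A2 p n * qpoch A3 p n)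
  / (qpoch p p n * qpoch B1 p n * qpoch B2 p n) * z ^ n.

Definition phi32 (A1 A2 A3 B1 B2 p z : C) : C :=
  CSeries (phi32_term A1 A2 A3 B1 B2 p z).

(* The sum of [f j] over the integers -n <= j <= n. *)
Definition sum_sym (f : Z -> C) (n : nat) : C :=
  sum_n (fun k : nat => f (Z.of_nat k - Z.of_nat n)%Z) (2 * n).

(* For |j| <= n the exponent 2n^2 - j^2 is nonnegative, so that [Z.to_nat]
   does not truncate it. *)
Definition hecke_term (q a b : C) (n : nat) (j : Z) : C :=
  (1 - q ^ (4 * n + 2))
  * ((qpoch (q ^ 2 / a) (q ^ 2) n * qpoch (q ^ 2 / b) (q ^ 2) n)
     / (qpoch (a * q ^ 2) (q ^ 2) n * qpoch (b * q ^ 2) (q ^ 2) n))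
  * (a * b) ^ n
  * q ^ Z.to_nat (2 * Z.of_nat n ^ 2 - j ^ 2).

Lemma CSeries_unique (u : nat -> C) (l : C) : is_series u l -> CSeries u = l.
Proof. exact (iota_filterlim_locally (sum_n u) l). Qed.

Lemma Cmod_qpoch_le (x p : C) (n : nat) : (Cmod p < 1)%R ->
  (Cmod (qpoch x p n) <= exp (Cmod x / (1 - Cmod p) * (1 - Cmod p ^ n)))%R.
Proof.
intros Hp; induction n as [|n IH].
- simpl; rewrite Cmod_1, Rminus_diag, Rmult_0_r, exp_0; lra.
- simpl qpoch; rewrite Cmod_mult.
  replace (Cmod x / (1 - Cmod p) * (1 - Cmod p ^ S n))%R
    with (Cmod x / (1 - Cmod p) * (1 - Cmod p ^ n) + Cmod x * Cmod p ^ n)%R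
    by (simpl; field; lra).
  rewrite exp_plus.
  apply Rmult_le_compat; try apply Cmod_ge_0; [exact IH|].
  apply Rle_trans with (1 + Cmod x * Cmod p ^ n)%R; [|apply exp_ineq1_le].
  unfold Cminus; eapply Rle_trans; [apply Cmod_triangle|].
  rewrite Cmod_1, Cmod_opp, Cmod_mult, Cmod_pow; lra.
Qed.

Lemma qpoch_inf_correct (x p : C) : (Cmod p < 1)%R ->
  filterlim (qpoch x p) eventually (locally (qpoch_inf x p)).
Proof.
intros Hp.
pose (d := fun n => qpoch x p (S n) - qpoch x p n).
assert (Hd : ex_series d).
{ pose (M := exp (Cmod x / (1 - Cmod p))).
  apply (@ex_series_le C_AbsRing C_CompleteNormedModule)
    with (fun n => scal (M * Cmod x)%R (Cmod p ^ n)%R).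
  - intros n; change (Cmod (d n) <= scal (M * Cmod x)%R (Cmod p ^ n)%R)%R.
    unfold d; simpl qpoch.
    replace (_ - _) with (- (qpoch x p n * (x * p ^ n))) by ring.
    rewrite Cmod_opp, !Cmod_mult, Cmod_pow, <- Rmult_assoc.
    pose proof (Cmod_ge_0 x); pose proof (Cmod_ge_0 p).
    assert (H1 : (0 <= Cmod p ^ n)%R) by now apply pow_le.
    change (scal ?u ?v) with (u * v)%R.
    do 2 (apply Rmult_le_compat_r; [assumption|]).
    eapply Rle_trans; [now apply Cmod_qpoch_le|].
    apply Rnot_lt_le; intros Hlt; apply exp_lt_inv in Hlt; revert Hlt.
    apply Rle_not_lt.
    rewrite <- (Rmult_1_r (Cmod x / _)) at 2.
    apply Rmult_le_compat_l; [|lra].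
    apply Rdiv_le_0_compat; lra.
  - apply (@ex_series_scal R_AbsRing R_NormedModule), ex_series_geom.
    now rewrite Rabs_pos_eq; [|apply Cmod_ge_0]. }
destruct Hd as [l Hl].
assert (Hs : forall n, sum_n d n = qpoch x p (S n) - 1).
{ induction n as [|n IH].
  - rewrite sum_O; reflexivity.
  - rewrite sum_Sn, IH; unfold d.
    change (qpoch x p (S n) - 1 + (qpoch x p (S (S n)) - qpoch x p (S n))
            = qpoch x p (S (S n)) - 1); ring. }
assert (Hlim : filterlim (qpoch x p) eventually (locally (l + 1 : C))).
{ assert (H : filterlim (fun n => plus (sum_n d n) (RtoC 1)) eventually
                (locally (plus l (RtoC 1)))).
  { eapply filterlim_comp_2; [exact Hl|apply filterlim_const|].
    apply (filterlim_plus l (RtoC 1)). }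
  intros P HP; destruct (H P HP) as [N HN].
  exists (S N); intros [|n] Hn; [lia|].
  specialize (HN n ltac:(lia)); rewrite Hs in HN.
  change (P (qpoch x p (S n) - 1 + 1)) in HN.
  now replace (qpoch x p (S n)) with (qpoch x p (S n) - 1 + 1) by ring. }
replace (qpoch_inf x p) with (l + 1 : C); [exact Hlim|].
symmetry; exact (iota_filterlim_locally (V := C_CompleteNormedModule) _ _ Hlim).
Qed.

(* Main.v *)
(* With p = q^2, the identity is Bailey's lemma at a = p, with parameters p/a
   and p/b, for the Bailey pair

     alpha_n = (1 - q^(4n+2)) sum_{|j| <= n} q^(2n^2 - j^2),
     beta_n = (-q;p)_n / ((p;p)_n (q;p)_n (-p;p)_n).

   Since U_r - U_(r+1) = (1 - p^(2r+1)) p^(r^2) / ((p;p)_(n-r) (p;p)_(n+r+1))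
   for U_r = p^(r^2) / ((p;p)_(n-r) (p;p)_(n+r)), summation by parts reduces
   the Bailey pair relation to the finite Jacobi triple product at z = 1, an
   instance of the q-binomial theorem.  Bailey's lemma is used in its finite
   form, where it follows from the q-Saalschutz sum, and both sides converge
   by Tannery's theorem (dominated convergence for series). *)
Require Import Defs.
From Stdlib Require Import Reals ZArith Lia Lra.
From Coquelicot Require Import Coquelicot.
Open Scope C_scope.

(** * Finite sums of complex numbers *)

(* [sum_n] with values typed in [C] itself, which [ring] and [field] recognize. *)
Definition Csum (u : nat -> C) (n : nat) : C := sum_n u n.

Lemma Csum_0 (u : nat -> C) : Csum u 0 = u O.
Proof. exact (sum_O u). Qed.

Lemma Csum_S (u : nat -> C) (n : nat) : Csum u (S n) = Csum u n + u (S n).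
Proof. exact (sum_Sn u n). Qed.

Lemma Csum_mult_l (c : C) (u : nat -> C) (n : nat) :
  Csum (fun k => c * u k) n = c * Csum u n.
Proof. exact (sum_n_mult_l (K := C_Ring) c u n). Qed.

Lemma Csum_plus (u v : nat -> C) (n : nat) :
  Csum (fun k => u k + v k) n = Csum u n + Csum v n.
Proof. exact (sum_n_plus (G := C_AbelianMonoid) u v n). Qed.

Lemma Csum_minus (u v : nat -> C) (n : nat) :
  Csum (fun k => u k - v k) n = Csum u n - Csum v n.
Proof.
induction n as [|n IH]; [now rewrite !Csum_0|].
rewrite !Csum_S, IH; ring.
Qed.

Lemma Csum_ext (u v : nat -> C) (n : nat) :
  (forall k, (k <= n)%nat -> u k = v k) -> Csum u n = Csum v n.
Proof. exact (sum_n_ext_loc u v n). Qed.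

Lemma Csum_first (u : nat -> C) (n : nat) :
  Csum u (S n) = u O + Csum (fun k => u (S k)) n.
Proof.
induction n as [|n IH]; [now rewrite Csum_S, !Csum_0|].
rewrite Csum_S, IH, (Csum_S (fun k => u (S k))); ring.
Qed.

(** Both sides run over the triangle r <= n <= N, on the right by columns r with n = r + k. In the
    induction, the new row extends every column r <= N by one entry and opens a column with a single
    entry. *)
Lemma Csum_triangle (f : nat -> nat -> C) (N : nat) :
  Csum (fun n => Csum (f n) n) N
  = Csum (fun r => Csum (fun k => f (r + k)%nat r) (N - r)) N.
Proof.
induction N as [|N IH]; [now rewrite !Csum_0|].
rewrite (Csum_S _ N), IH, (Csum_S _ N).
rewrite (Csum_S (fun r => Csum (fun k => f (r + k)%nat r) (S N - r))).
rewrite Nat.sub_diag, Csum_0, Nat.add_0_r, Cplus_assoc, <- Csum_plus; f_equal.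
apply Csum_ext; intros r Hr.
rewrite Nat.sub_succ_l by exact Hr.
rewrite Csum_S; do 2 f_equal; lia.
Qed.

(** * Nonvanishing and splitting of shifted factorials *)

Lemma Cmult_eq_reg_l (c x y : C) : c <> 0 -> c * x = c * y -> x = y.
Proof.
intros Hc H; replace x with (c * x / c) by (field; exact Hc).
rewrite H; field; exact Hc.
Qed.

Lemma Cinv_mult (x y : C) : x <> 0 -> y <> 0 -> / (x * y) = / x * / y.
Proof. intros Hx Hy; field; auto. Qed.

Lemma Cinv_neq0 (x : C) : x <> 0 -> / x <> 0.
Proof. intros Hx E; apply C1_nz; rewrite <- (Cinv_l x Hx), E; ring. Qed.

Lemma one_minus_neq0 (x : C) : (Cmod x < 1)%R -> 1 - x <> 0.
Proof.
intros Hx H; apply Ceq_minus in H; subst x.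
rewrite Cmod_1 in Hx; lra.
Qed.

Lemma Cmod_mult_pow_lt1 (x p : C) (n : nat) :
  (Cmod x < 1)%R -> (Cmod p < 1)%R -> (Cmod (x * p ^ n) < 1)%R.
Proof.
intros Hx Hp; rewrite Cmod_mult, Cmod_pow.
pose proof (Cmod_ge_0 x); pose proof (Cmod_ge_0 p).
assert (0 <= Cmod p ^ n <= 1)%R.
{ split; [now apply pow_le|]. rewrite <- (pow1 n). apply pow_incr; lra. }
nra.
Qed.

Lemma qpoch_neq0 (x p : C) (n : nat) :
  (Cmod x < 1)%R -> (Cmod p < 1)%R -> qpoch x p n <> 0.
Proof.
intros Hx Hp; induction n as [|n IH]; simpl; [exact C1_nz|].
apply Cmult_neq_0; [exact IH|].
now apply one_minus_neq0, Cmod_mult_pow_lt1.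
Qed.

Lemma qpoch_S (x p : C) (n : nat) :
  qpoch x p (S n) = qpoch x p n * (1 - x * p ^ n).
Proof. reflexivity. Qed.

Lemma qpoch_add (x p : C) (m n : nat) :
  qpoch x p (m + n) = qpoch x p m * qpoch (x * p ^ m) p n.
Proof.
induction n as [|n IH]; [rewrite Nat.add_0_r; simpl; ring|].
rewrite Nat.add_succ_r, !qpoch_S, IH, Cpow_add_r; ring.
Qed.

Lemma qpoch_factor_neq0 (x p : C) (n : nat) :
  (forall k, qpoch x p k <> 0) -> 1 - x * p ^ n <> 0.
Proof.
intros H E; apply (H (S n)); rewrite qpoch_S, E; ring.
Qed.

(** * The q-Saalschutz sum and the q-binomial theorem *)

(** For k + m = M, this is the k-th term of the terminating balanced 3phi2 with lower parameter C =
    A B Z, so Z = C / (A B). The usual numerator parameter p^(-M) is absorbed into the factors of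
    index m, which avoids negative powers of p. *)
Definition saalschutz_term (A B Z p : C) (k m : nat) : C :=
  qpoch A p k * qpoch B p k * qpoch Z p m * Z ^ k
  / (qpoch p p k * qpoch p p m * qpoch (A * B * Z) p k).

(* With [t M k] the [k]-th term for [M], the WZ-style identity is
   (1 - p^(M+1)) (1 - A B Z p^M) t (M+1) k - (1 - B Z p^M) (1 - A Z p^M) t M k
   = H (k-1) - H k, where [- H j] is the right-hand side at [j + m = M]. *)
Lemma saalschutz_telescope (A B Z p : C) (j m : nat) :
  (forall k, qpoch p p k <> 0) -> (forall k, qpoch (A * B * Z) p k <> 0) ->
  Csum (fun k =>
      (1 - p * p ^ (j + m)) * (1 - A * B * Z * p ^ (j + m))
        * saalschutz_term A B Z p k (S (j + m) - k)
      - (1 - B * Z * p ^ (j + m)) * (1 - A * Z * p ^ (j + m))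
        * saalschutz_term A B Z p k (j + m - k)) j
  = - (p ^ m * qpoch A p (S j) * qpoch B p (S j) * qpoch Z p m * Z ^ S j
       / (qpoch p p j * qpoch p p m * qpoch (A * B * Z) p j)).
Proof.
intros Hp HC; revert m; induction j as [|j IH]; intros m.
- rewrite Csum_0, Nat.add_0_l, !Nat.sub_0_r; unfold saalschutz_term.
  rewrite !qpoch_S, !Cpow_S; simpl (qpoch _ _ 0); simpl (_ ^ 0).
  field; repeat split; auto using qpoch_factor_neq0.
- rewrite Csum_S.
  (* The induction keeps M fixed: passing from j to j + 1 uses the hypothesis at m + 1, which is why
     m is generalized. *)
  replace (S j + m)%nat with (j + S m)%nat by lia; rewrite IH.
  replace (S (j + S m) - S j)%nat with (S m) by lia.
  replace (j + S m - S j)%nat with m by lia.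
  unfold saalschutz_term; rewrite !qpoch_S, !Cpow_add_r, !Cpow_S.
  field; repeat split; auto using qpoch_factor_neq0.
Qed.

Lemma q_saalschutz (A B Z p : C) (M : nat) :
  (forall k, qpoch p p k <> 0) -> (forall k, qpoch (A * B * Z) p k <> 0) ->
  Csum (fun k => saalschutz_term A B Z p k (M - k)) M
  = qpoch (A * Z) p M * qpoch (B * Z) p M
    / (qpoch p p M * qpoch (A * B * Z) p M).
Proof.
intros Hp HC; induction M as [|M IH].
- rewrite Csum_0; unfold saalschutz_term; simpl; field.
(* At j = M and m = 0 the telescoped sum is a first-order recurrence in M. It covers only k <= M, so
   the term k = M + 1 of the next sum is added by hand. *)
- pose proof (saalschutz_telescope A B Z p M 0 Hp HC) as H.
  rewrite Nat.add_0_r, Csum_minus, !Csum_mult_l, IH in H.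
  assert (H1 := qpoch_factor_neq0 _ _ M Hp).
  assert (H2 := qpoch_factor_neq0 _ _ M HC).
  rewrite Csum_S, Nat.sub_diag.
  apply (Cmult_eq_reg_l ((1 - p * p ^ M) * (1 - A * B * Z * p ^ M)));
    [now apply Cmult_neq_0|].
  rewrite Cmult_plus_distr_l.
  match type of H with
  | ?x - ?y = ?z => replace x with (z + y) by (rewrite <- H; ring)
  end.
  unfold saalschutz_term; rewrite !qpoch_S, !Cpow_S; simpl (qpoch _ _ 0); simpl (_ ^ 0).
  field; auto.
Qed.

(* The recurrence on [w] means [w k = w 0 * x^k * p^(k(k-1)/2)]. *)
Lemma q_binomial (x p : C) (w : nat -> C) (N : nat) :
  (forall k, qpoch p p k <> 0) ->
  (forall k, w (S k) = w k * (x * p ^ k)) ->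
  Csum (fun k => w k / (qpoch p p k * qpoch p p (N - k))) N
  = w O * qpoch (- x) p N / qpoch p p N.
Proof.
intros Hp Hw; induction N as [|N IH].
- rewrite Csum_0; simpl; field.
- apply (Cmult_eq_reg_l (1 - p * p ^ N)); [now apply qpoch_factor_neq0|].
  transitivity ((1 + x * p ^ N) * Csum (fun k => w k / (qpoch p p k * qpoch p p (N - k))) N).
  2:{ rewrite IH, !qpoch_S; field; auto using qpoch_factor_neq0. }
  (* [1 - p^(N+1) = (1 - p^(N+1-k)) + p^(N+1-k) (1 - p^k)] *)
  assert (H : Csum (fun k => (1 - p ^ (S N - k)) *
                (w k / (qpoch p p k * qpoch p p (S N - k)))) (S N)
            = Csum (fun k => w k / (qpoch p p k * qpoch p p (N - k))) N).
  { rewrite Csum_S, Nat.sub_diag; simpl (p ^ 0).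
    transitivity (Csum (fun k => w k / (qpoch p p k * qpoch p p (N - k))) N + 0);
      [|ring].
    f_equal; [|unfold Cdiv; ring].
    apply Csum_ext; intros k Hk; rewrite Nat.sub_succ_l, qpoch_S, Cpow_S by exact Hk.
    field; auto using qpoch_factor_neq0. }
  (* The factor 1 - p^k kills k = 0 and lowers (p;p)_k; after the shift of k, the ratio x p^k of [w]
     and the power p^(N-k) combine to x p^N. *)
  assert (H' : Csum (fun k => p ^ (S N - k) * (1 - p ^ k) *
                (w k / (qpoch p p k * qpoch p p (S N - k)))) (S N)
            = x * p ^ N * Csum (fun k => w k / (qpoch p p k * qpoch p p (N - k))) N).
  { rewrite Csum_first, <- Csum_mult_l; simpl (p ^ 0).
    match goal with |- ?a + ?b = ?c => transitivity (0 + b) end;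
      [f_equal; unfold Cdiv; ring|rewrite Cplus_0_l].
    apply Csum_ext; intros k Hk.
    rewrite Nat.sub_succ, Hw, qpoch_S, Cpow_S.
    replace (p ^ N) with (p ^ (N - k) * p ^ k)
      by (rewrite <- Cpow_add_r; f_equal; lia).
    field; auto using qpoch_factor_neq0. }
  rewrite Cmult_plus_distr_r, Cmult_1_l, <- H', <- H, <- Csum_plus, <- Csum_mult_l.
  apply Csum_ext; intros k Hk.
  rewrite <- Cpow_S.
  replace (p ^ S N) with (p ^ (S N - k) * p ^ k)
    by (rewrite <- Cpow_add_r; f_equal; lia).
  ring.
Qed.

(** * The finite Bailey lemma *)

(** The base point is p and the parameters are x and y, so z = p^2 / (x y), x z = p^2 / y and y z =
    p^2 / x. As (p^2;p)_(n+r) = (p;p)_(n+r+1) / (1 - p), [alpha] is 1 - p times the usual one. Once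
    [beta] is expanded and the sums are exchanged, the inner sum over n = r + k is a q-Saalschutz
    sum with parameters x p^r, y p^r and z. *)
Lemma bailey_lemma_finite (x y z p : C) (alpha beta : nat -> C) (N : nat) :
  (forall k, qpoch p p k <> 0) ->
  (forall k, qpoch (x * z) p k <> 0) ->
  (forall k, qpoch (y * z) p k <> 0) ->
  x * y * z = p ^ 2 ->
  (forall n, beta n = Csum (fun r =>
     alpha r / (qpoch p p (n - r) * qpoch p p (n + r + 1))) n) ->
  Csum (fun n => qpoch x p n * qpoch y p n * z ^ n * beta n
                 * (qpoch z p (N - n) / qpoch p p (N - n))) N
  = qpoch (x * z) p N * qpoch (y * z) p N
    * Csum (fun r => qpoch x p r * qpoch y p r
                     / (qpoch (x * z) p r * qpoch (y * z) p r) * z ^ r * alpha r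
                     / (qpoch p p (N - r) * qpoch p p (N + r + 1))) N.
Proof.
intros Hp Hx Hy Hxyz Hbeta.
rewrite (Csum_ext _ (fun n => Csum (fun r =>
  qpoch x p n * qpoch y p n * z ^ n * (qpoch z p (N - n) / qpoch p p (N - n))
  * (alpha r / (qpoch p p (n - r) * qpoch p p (n + r + 1)))) n)).
2:{ intros n _; rewrite Csum_mult_l, Hbeta; ring. }
rewrite (Csum_triangle (fun n r =>
  qpoch x p n * qpoch y p n * z ^ n * (qpoch z p (N - n) / qpoch p p (N - n))
  * (alpha r / (qpoch p p (n - r) * qpoch p p (n + r + 1))))).
rewrite <- Csum_mult_l; apply Csum_ext; intros r Hr.
set (M := (N - r)%nat); replace N with (r + M)%nat by lia; clearbody M.
set (A := x * p ^ r); set (B := y * p ^ r).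
(* The constraint on x y z makes the lower Saalschutz parameter p^(2r+2), so (p;p)_(2r+1+k) splits
   as (p;p)_(2r+1) (A B z;p)_k. *)
assert (HC : A * B * z = p * p ^ (r + r + 1)).
{ unfold A, B; replace (x * p ^ r * (y * p ^ r) * z) with (x * y * z * (p ^ r * p ^ r)) by ring.
  rewrite Hxyz, !Cpow_add_r, Cpow_1_r; simpl; ring. }
remember (r + r + 1)%nat as s eqn:Hs.
assert (Hadd : forall k, qpoch p p (s + k) = qpoch p p s * qpoch (A * B * z) p k).
{ intros k; rewrite HC; apply qpoch_add. }
assert (HC0 : forall k, qpoch (A * B * z) p k <> 0).
{ intros k E; apply (Hp (s + k)%nat); rewrite Hadd, E; ring. }
transitivity (qpoch x p r * qpoch y p r * z ^ r * alpha r / qpoch p p s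
  * Csum (fun k => saalschutz_term A B z p k (M - k)) M).
- rewrite <- Csum_mult_l; apply Csum_ext; intros k Hk.
  replace (r + M - (r + k))%nat with (M - k)%nat by lia.
  replace (r + k - r)%nat with k by lia.
  replace (r + k + r + 1)%nat with (s + k)%nat by lia.
  rewrite Hadd, !qpoch_add, Cpow_add_r; unfold saalschutz_term; fold A B.
  field; auto.
- rewrite q_saalschutz by assumption.
  replace (r + M + r + 1)%nat with (s + M)%nat by lia.
  rewrite Hadd, !qpoch_add.
  replace (A * z) with (x * z * p ^ r) by (unfold A; ring).
  replace (B * z) with (y * z * p ^ r) by (unfold B; ring).
  field; auto 10.
Qed.

(** * Symmetric sums and the Bailey pair *)

Lemma sum_sym_S (f : Z -> C) (n : nat) :
  sum_sym f (S n)
  = sum_sym f n + f (Z.of_nat (S n)) + f (- Z.of_nat (S n))%Z.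
Proof.
change (sum_sym f (S n))
  with (Csum (fun k => f (Z.of_nat k - Z.of_nat (S n))%Z) (2 * S n)).
replace (2 * S n)%nat with (S (S (2 * n))) by lia.
rewrite Csum_S, Csum_first.
rewrite (Csum_ext _ (fun k => f (Z.of_nat k - Z.of_nat n)%Z))
  by (intros k _; f_equal; lia).
change (sum_sym f n) with (Csum (fun k => f (Z.of_nat k - Z.of_nat n)%Z) (2 * n)).
replace (Z.of_nat (S (S (2 * n))) - Z.of_nat (S n))%Z with (Z.of_nat (S n)) by lia.
replace (Z.of_nat 0 - Z.of_nat (S n))%Z with (- Z.of_nat (S n))%Z by lia.
ring.
Qed.

Lemma sum_sym_ext (f g : Z -> C) (n : nat) :
  (forall j, (- Z.of_nat n <= j <= Z.of_nat n)%Z -> f j = g j) ->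
  sum_sym f n = sum_sym g n.
Proof. intros H; apply Csum_ext; intros k Hk; apply H; lia. Qed.

Lemma sum_sym_mult_l (c : C) (f : Z -> C) (n : nat) :
  sum_sym (fun j => c * f j) n = c * sum_sym f n.
Proof. exact (Csum_mult_l c _ _). Qed.

Lemma Z_to_nat_sqr (z : Z) (m : nat) :
  Z.abs z = Z.of_nat m -> Z.to_nat (z ^ 2) = (m * m)%nat.
Proof. intros H; replace (z ^ 2)%Z with (Z.of_nat (m * m)) by nia; apply Nat2Z.id. Qed.

Lemma Cpow_sqr (q : C) (n : nat) : (q ^ 2) ^ n = q ^ n * q ^ n.
Proof. rewrite <- Cpow_mult_l; f_equal; simpl; ring. Qed.

(** Factor 1 - q^(2m) = (1 - q^m) (1 + q^m) for 1 <= m <= 2n and separate odd m from even m. *)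
Lemma qpoch_sqr_double (q : C) (n : nat) :
  qpoch (q ^ 2) (q ^ 2) (2 * n)
  = qpoch q (q ^ 2) n * qpoch (- q) (q ^ 2) n
    * (qpoch (q ^ 2) (q ^ 2) n * qpoch (- q ^ 2) (q ^ 2) n).
Proof.
induction n as [|n IH]; [simpl; ring|].
replace (2 * S n)%nat with (S (S (2 * n))) by lia.
rewrite !qpoch_S, IH, (Cpow_S (q ^ 2)).
replace (2 * n)%nat with (n + n)%nat by lia; rewrite Cpow_add_r, !Cpow_sqr.
ring.
Qed.

(** The factors on the left are 1 + q^(-(2i-1)) = q^(-(2i-1)) (1 + q^(2i-1)) for 1 <= i <= n, and
    these odd numbers add up to n^2. *)
Lemma qpoch_reflect (q : C) (n : nat) : q <> 0 ->
  q ^ (n * n) * qpoch (- (q * / (q ^ 2) ^ n)) (q ^ 2) n = qpoch (- q) (q ^ 2) n.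
Proof.
intros Hq; induction n as [|n IH]; [simpl; ring|].
rewrite (qpoch_S (- q)), <- IH.
rewrite (qpoch_add _ _ 1 n : qpoch _ _ (S n) = _).
replace (- (q * / (q ^ 2) ^ S n) * (q ^ 2) ^ 1) with (- (q * / (q ^ 2) ^ n)).
2:{ rewrite (Cpow_S (q ^ 2)), Cpow_1_r; field.
    split; [now apply Cpow_nz, Cpow_nz|assumption]. }
replace (S n * S n)%nat with (n * n + (n + n + 1))%nat by lia.
replace (qpoch _ _ 1) with (1 - - (q * / (q ^ 2) ^ S n)) by (simpl; ring).
rewrite !(Cpow_add_r q), (Cpow_S (q ^ 2)), !Cpow_sqr, Cpow_1_r.
simpl (_ ^ 0); field; auto using Cpow_nz.
Qed.

(** This is the q-binomial theorem of order 2n in base q^2, with k = n + j and x = q^(1-2n). Of the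
    2n factors of (-x;q^2)_(2n), the first n are reflected with the help of w 0 = q^(n^2), and the
    last n already form (-q;q^2)_n. *)
Lemma finite_jacobi_triple (q : C) (n : nat) : q <> 0 ->
  (forall k, qpoch (q ^ 2) (q ^ 2) k <> 0) ->
  sum_sym (fun j => q ^ Z.to_nat (j ^ 2)
     / (qpoch (q ^ 2) (q ^ 2) (Z.to_nat (Z.of_nat n + j))
        * qpoch (q ^ 2) (q ^ 2) (Z.to_nat (Z.of_nat n - j)))) n
  = qpoch (- q) (q ^ 2) n * qpoch (- q) (q ^ 2) n / qpoch (q ^ 2) (q ^ 2) (2 * n).
Proof.
intros Hq Hp.
assert (Hq2 : forall k, (q ^ 2) ^ k <> 0) by (intros k; now apply Cpow_nz, Cpow_nz).
pose (w := fun k => q ^ Z.to_nat ((Z.of_nat k - Z.of_nat n) ^ 2)).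
transitivity (Csum (fun k => w k / (qpoch (q ^ 2) (q ^ 2) k
                                   * qpoch (q ^ 2) (q ^ 2) (2 * n - k))) (2 * n)).
- apply Csum_ext; intros k Hk; unfold w.
  now replace (Z.to_nat (Z.of_nat n + (Z.of_nat k - Z.of_nat n))) with k by lia;
  replace (Z.to_nat (Z.of_nat n - (Z.of_nat k - Z.of_nat n))) with (2 * n - k)%nat by lia.
- rewrite (q_binomial (q * / (q ^ 2) ^ n)); [|exact Hp|].
  + unfold w; rewrite (Z_to_nat_sqr _ n) by lia.
    replace (2 * n)%nat with (n + n)%nat by lia.
    rewrite (qpoch_add _ _ n n), Cmult_assoc, qpoch_reflect by exact Hq.
    replace (- (q * / (q ^ 2) ^ n) * (q ^ 2) ^ n) with (- q)
      by (field; auto).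
    reflexivity.
  (* The ratio is q^(2(k-n)+1); with natural exponents the cases k >= n and k < n are checked
     separately. *)
  + intros k; unfold w; destruct (Nat.le_gt_cases n k) as [H|H].
    * replace k with (n + (k - n))%nat by lia; set (d := (k - n)%nat).
      rewrite (Z_to_nat_sqr _ (S d)), (Z_to_nat_sqr _ d) by lia.
      replace (S d * S d)%nat with (d * d + d + d + 1)%nat by lia.
      rewrite !Cpow_add_r, Cpow_1_r, (Cpow_sqr _ d); field; auto.
    * set (d := (n - S k)%nat); replace n with (k + S d)%nat by lia.
      rewrite (Z_to_nat_sqr _ d), (Z_to_nat_sqr _ (S d)) by lia.
      replace (S d * S d)%nat with (d * d + d + d + 1)%nat by lia.
      rewrite !Cpow_add_r, Cpow_1_r, (Cpow_S (q ^ 2)), (Cpow_sqr _ d).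
      field; auto using Cpow_nz.
Qed.

(* [p^(j^2) q^(-j^2) = q^(j^2)] on the right.  The boundary term is [U_(m+1)]
   times the inner sum, written so that it vanishes at [m = n]. *)
Lemma hecke_abel_summation (q : C) (n m : nat) : q <> 0 ->
  (forall k, qpoch (q ^ 2) (q ^ 2) k <> 0) -> (m <= n)%nat ->
  Csum (fun r => (1 - q ^ (4 * r + 2)) * q ^ (2 * (r * r))
                 * sum_sym (fun j => (/ q) ^ Z.to_nat (j ^ 2)) r
                 / (qpoch (q ^ 2) (q ^ 2) (n - r)
                    * qpoch (q ^ 2) (q ^ 2) (n + r + 1))) m
  = sum_sym (fun j => q ^ Z.to_nat (j ^ 2)
     / (qpoch (q ^ 2) (q ^ 2) (Z.to_nat (Z.of_nat n + j))
        * qpoch (q ^ 2) (q ^ 2) (Z.to_nat (Z.of_nat n - j)))) m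
    - q ^ (2 * (S m * S m)) * (1 - (q ^ 2) ^ (n - m))
      / (qpoch (q ^ 2) (q ^ 2) (n - m) * qpoch (q ^ 2) (q ^ 2) (n + m + 1))
      * sum_sym (fun j => (/ q) ^ Z.to_nat (j ^ 2)) m.
Proof.
intros Hq Hp; induction m as [|m IH]; intros Hm.
- rewrite Csum_0.
  assert (H0 : forall f : Z -> C, sum_sym f 0 = f 0%Z) by (intros f; exact (Csum_0 _)).
  rewrite !H0, Nat.sub_0_r, !Nat.add_0_r, Z.add_0_r, Z.sub_0_r, Nat2Z.id.
  change (Z.to_nat (0 ^ 2)) with 0%nat.
  rewrite Nat.add_1_r, qpoch_S, Cpow_sqr; simpl (_ * _)%nat.
  assert (H1 := qpoch_factor_neq0 _ _ n Hp); rewrite Cpow_sqr in H1.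
  change (0 + 2)%nat with 2%nat; simpl (_ ^ 0).
  field; auto.
- rewrite Csum_S, IH, !sum_sym_S by lia.
  set (d := (n - S m)%nat); replace n with (S m + d)%nat by lia; clearbody d.
  rewrite !(Z_to_nat_sqr _ (S m)) by lia.
  replace (S m + d - m)%nat with (S d) by lia.
  replace (S m + d - S m)%nat with d by lia.
  (* The new indices j = m + 1 and j = -(m + 1) contribute equally: they only exchange n + j and n -
     j. *)
  replace (Z.to_nat (Z.of_nat (S m + d) + Z.of_nat (S m)))
    with (S m + d + m + 1)%nat by lia.
  replace (Z.to_nat (Z.of_nat (S m + d) - Z.of_nat (S m))) with d by lia.
  replace (Z.to_nat (Z.of_nat (S m + d) + - Z.of_nat (S m))) with d by lia.
  replace (Z.to_nat (Z.of_nat (S m + d) - - Z.of_nat (S m)))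
    with (S m + d + m + 1)%nat by lia.
  replace (S m + d + S m + 1)%nat with (S (S m + d + m + 1)) by lia.
  rewrite (qpoch_S _ _ (S m + d + m + 1)), (qpoch_S _ _ d).
  assert (H1 := qpoch_factor_neq0 _ _ d Hp).
  assert (H2 := qpoch_factor_neq0 _ _ (S m + d + m + 1) Hp).
  rewrite Cpow_inv by exact Hq.
  replace (2 * (S (S m) * S (S m)))%nat
    with (S m * S m + S m * S m + (m + m + m + m + 6))%nat by lia.
  replace (2 * (S m * S m))%nat with (S m * S m + S m * S m)%nat by lia.
  replace (4 * S m + 2)%nat with (m + m + m + m + 6)%nat by lia.
  replace (S m + d + m + 1)%nat with (m + m + d + 2)%nat in * by lia.
  rewrite (Cpow_S (q ^ 2)), (Cpow_add_r (q ^ 2) _ 2), !(Cpow_add_r (q ^ 2) _ d), !(Cpow_add_r (q ^ 2) m m) in *.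
  rewrite !(Cpow_add_r q), !Cpow_sqr in *.
  field; repeat split; auto using Cpow_nz.
  intros E; apply H2; rewrite <- E; ring.
Qed.

(** Summation by parts up to m = n has no boundary term, since 1 - (q^2)^0 = 0. The finite triple
    product remains, and factoring (q^2;q^2)_(2n) cancels one of its two factors (-q;q^2)_n. *)
Lemma hecke_bailey_pair (q : C) (n : nat) : q <> 0 -> (Cmod q < 1)%R ->
  qpoch (- q) (q ^ 2) n
  / (qpoch (q ^ 2) (q ^ 2) n * qpoch q (q ^ 2) n * qpoch (- q ^ 2) (q ^ 2) n)
  = Csum (fun r =>
      (1 - q ^ (4 * r + 2))
      * sum_sym (fun j => q ^ Z.to_nat (2 * Z.of_nat r ^ 2 - j ^ 2)) r
      / (qpoch (q ^ 2) (q ^ 2) (n - r) * qpoch (q ^ 2) (q ^ 2) (n + r + 1))) n.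
Proof.
intros Hq Hq1.
assert (Hp : (Cmod (q ^ 2) < 1)%R).
{ rewrite Cmod_pow; pose proof (Cmod_ge_0 q); nra. }
assert (Hp0 : forall k, qpoch (q ^ 2) (q ^ 2) k <> 0)
  by (intros k; now apply qpoch_neq0).
transitivity (Csum (fun r => (1 - q ^ (4 * r + 2)) * q ^ (2 * (r * r))
    * sum_sym (fun j => (/ q) ^ Z.to_nat (j ^ 2)) r
    / (qpoch (q ^ 2) (q ^ 2) (n - r) * qpoch (q ^ 2) (q ^ 2) (n + r + 1))) n).
- rewrite hecke_abel_summation, finite_jacobi_triple by (auto; lia).
  rewrite Nat.sub_diag, qpoch_sqr_double; simpl (_ ^ 0).
  assert (Hm : forall x, (Cmod x < 1)%R -> qpoch x (q ^ 2) n <> 0)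
    by (intros x Hx; now apply qpoch_neq0).
  simpl (qpoch _ _ 0); field.
  repeat split; auto; apply Hm; now rewrite ?Cmod_opp.
(* The power q^(2r^2) moves inside the inner sum, where |j| <= r makes 2r^2 - j^2 nonnegative. *)
- apply Csum_ext; intros r _; f_equal.
  rewrite <- Cmult_assoc, <- sum_sym_mult_l; f_equal.
  apply sum_sym_ext; intros j Hj.
  rewrite (Z_to_nat_sqr _ (Z.abs_nat j)) by lia.
  set (k := Z.to_nat (2 * Z.of_nat r ^ 2 - j ^ 2)).
  replace (2 * (r * r))%nat with (k + Z.abs_nat j * Z.abs_nat j)%nat by (unfold k; nia).
  rewrite Cpow_add_r, Cpow_inv by exact Hq; field; now apply Cpow_nz.
Qed.

(** * Limits of complex sequences *)

(** Stated through real distances, so that squeezing and arithmetic of real limits apply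
    directly. *)
Definition Clim (u : nat -> C) (l : C) : Prop :=
  is_lim_seq (fun n => Cmod (u n - l)) 0%R.

Lemma Clim_filterlim (u : nat -> C) (l : C) :
  Clim u l <-> filterlim u eventually (locally l).
Proof.
unfold Clim; rewrite <- is_lim_seq_spec; split; intros H.
- apply (filterlim_locally (U := C_UniformSpace)); intros eps.
  destruct (H eps) as [N HN]; exists N; intros n Hn.
  apply (norm_compat1 (V := C_NormedModule) l (u n)).
  change (Cmod (u n - l) < eps)%R.
  specialize (HN n Hn).
  now rewrite Rminus_0_r, Rabs_pos_eq in HN by apply Cmod_ge_0.
- intros eps.
  (* A ball of the uniform structure of C controls the modulus only up to the constant
     [norm_factor], so the radius is divided by it. *)
  assert (Hf := norm_factor_gt_0 (V := C_NormedModule)).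
  assert (He : (0 < eps / norm_factor (V := C_NormedModule))%R)
    by (apply Rdiv_lt_0_compat; [apply cond_pos|exact Hf]).
  destruct (proj1 (filterlim_locally (U := C_UniformSpace) u l) H (mkposreal _ He))
    as [N HN]; exists N; intros n Hn.
  rewrite Rminus_0_r, Rabs_pos_eq by apply Cmod_ge_0.
  assert (K := norm_compat2 (V := C_NormedModule) l (u n) _ (HN n Hn)).
  change (Cmod (u n - l)
          < norm_factor (V := C_NormedModule) * (eps / norm_factor (V := C_NormedModule)))%R in K.
  now replace (norm_factor (V := C_NormedModule) * (eps / norm_factor (V := C_NormedModule)))%R
    with (pos eps) in K by (field; lra).
Qed.

Lemma Clim_squeeze (u : nat -> C) (l : C) (e : nat -> R) :
  (forall n, Cmod (u n - l) <= e n)%R -> is_lim_seq e 0%R -> Clim u l.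
Proof.
intros H He; refine (is_lim_seq_le_le _ _ _ _ _ (is_lim_seq_const 0) He).
intros n; split; [apply Cmod_ge_0|apply H].
Qed.

Lemma Clim_unique (u : nat -> C) (l m : C) : Clim u l -> Clim u m -> l = m.
Proof.
intros Hl Hm; apply Ceq_minus, Cmod_eq_0.
assert (H : is_lim_seq (fun n => Cmod (u n - l) + Cmod (u n - m))%R (0 + 0)%R)
  by now apply is_lim_seq_plus'.
assert (Hle : Rbar_le (Cmod (l - m)) (0 + 0)%R).
{ refine (is_lim_seq_le _ _ _ _ _ (is_lim_seq_const _) H).
  intros n; replace (l - m) with (- (u n - l) + (u n - m)) by ring.
  eapply Rle_trans; [apply Cmod_triangle|rewrite Cmod_opp; lra]. }
simpl in Hle; pose proof (Cmod_ge_0 (l - m)); lra.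
Qed.

Lemma Clim_mult (u v : nat -> C) (l m : C) :
  Clim u l -> Clim v m -> Clim (fun n => u n * v n) (l * m).
Proof.
intros Hu Hv.
apply Clim_squeeze with (fun n => Cmod (u n - l) * Cmod (v n - m)
  + (Cmod (u n - l) * Cmod m + Cmod l * Cmod (v n - m)))%R.
- intros n; rewrite <- !Cmod_mult.
  replace (u n * v n - l * m)
    with ((u n - l) * (v n - m) + ((u n - l) * m + l * (v n - m))) by ring.
  eapply Rle_trans; [apply Cmod_triangle|apply Rplus_le_compat_l, Cmod_triangle].
- replace 0%R with (0 * 0 + (0 * Cmod m + Cmod l * 0))%R by ring.
  apply is_lim_seq_plus'; [|apply is_lim_seq_plus']; apply is_lim_seq_mult';
    first [assumption | apply is_lim_seq_const].
Qed.

Lemma Clim_const (c : C) : Clim (fun _ => c) c.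
Proof.
apply Clim_squeeze with (fun _ => 0%R); [|apply is_lim_seq_const].
intros _; replace (c - c) with (RtoC 0) by ring; rewrite Cmod_0; lra.
Qed.

Lemma Clim_ext (u v : nat -> C) (l : C) :
  (forall n, u n = v n) -> Clim u l -> Clim v l.
Proof. intros H; apply is_lim_seq_ext; intros n; now rewrite H. Qed.

Lemma Clim_shift (u : nat -> C) (l : C) (k : nat) :
  Clim (fun n => u (n + k)%nat) l <-> Clim u l.
Proof. symmetry; exact (is_lim_seq_incr_n (fun n => Cmod (u n - l)) k 0%R). Qed.

(** Truncated subtraction alters only the finitely many entries with n < k. *)
Lemma Clim_shift_down (u : nat -> C) (l : C) (k : nat) :
  Clim u l -> Clim (fun n => u (n - k)%nat) l.
Proof.
intros H; apply (Clim_shift _ l k); revert H; apply Clim_ext.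
intros n; f_equal; lia.
Qed.

Definition Cbounded (u : nat -> C) : Prop :=
  exists K : R, forall n, (Cmod (u n) <= K)%R.

Lemma Cbounded_mult (u v : nat -> C) :
  Cbounded u -> Cbounded v -> Cbounded (fun n => u n * v n).
Proof.
intros [K HK] [L HL]; exists (K * L)%R; intros n; rewrite Cmod_mult.
apply Rmult_le_compat; auto using Cmod_ge_0.
Qed.

Lemma Cbounded_ext (u v : nat -> C) :
  (forall n, u n = v n) -> Cbounded u -> Cbounded v.
Proof. intros H [K HK]; exists K; intros n; rewrite <- H; apply HK. Qed.

(** A bound K on the reciprocals keeps |u n| above 1/K, hence l away from 0; then 1/u - 1/l = (l -
    u) / (u l) is at most K |1/l| |u - l|. *)
Lemma Clim_inv (u : nat -> C) (l : C) :
  (forall n, u n <> 0) -> Cbounded (fun n => / u n) -> Clim u l ->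
  l <> 0 /\ Clim (fun n => / u n) (/ l).
Proof.
intros Hu [K HK] Hl.
assert (Hlow : forall n, (1 <= K * Cmod (u n))%R).
{ intros n; rewrite <- Cmod_1, <- (Cinv_l (u n)), Cmod_mult by apply Hu.
  apply Rmult_le_compat_r; [apply Cmod_ge_0|apply HK]. }
assert (Hl0 : l <> 0).
{ intros ->.
  assert (H : is_lim_seq (fun n => K * Cmod (u n - 0))%R (K * 0)%R)
    by (apply is_lim_seq_mult'; [apply is_lim_seq_const|exact Hl]).
  assert (Hle : Rbar_le 1%R (K * 0)%R).
  { refine (is_lim_seq_le _ _ _ _ _ (is_lim_seq_const _) H).
    intros n; replace (u n - 0) with (u n) by ring; apply Hlow. }
  simpl in Hle; lra. }
split; [exact Hl0|].
apply Clim_squeeze with (fun n => K * Cmod (/ l) * Cmod (u n - l))%R.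
- intros n.
  replace (/ u n - / l) with (/ u n * / l * - (u n - l)) by (field; auto).
  rewrite !Cmod_mult, Cmod_opp.
  do 2 (apply Rmult_le_compat_r; [apply Cmod_ge_0|]); apply HK.
- replace 0%R with (K * Cmod (/ l) * 0)%R by ring.
  apply is_lim_seq_mult'; [apply is_lim_seq_const|exact Hl].
Qed.

(** * Tannery's theorem *)

Lemma Cmod_Csum_le (u : nat -> C) (M : nat -> R) (n : nat) :
  (forall k, (k <= n)%nat -> Cmod (u k) <= M k)%R -> (Cmod (Csum u n) <= sum_n M n)%R.
Proof.
induction n as [|n IH]; intros H; [rewrite Csum_0, sum_O; now apply H|].
rewrite Csum_S, sum_Sn; eapply Rle_trans; [apply Cmod_triangle|].
apply Rplus_le_compat; [apply IH; auto with arith|now apply H].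
Qed.

Lemma Cmod_Csum_tail_le (u : nat -> C) (M : nat -> R) (K d : nat) :
  (forall k, (k <= K + d)%nat -> Cmod (u k) <= M k)%R ->
  (Cmod (Csum u (K + d) - Csum u K) <= sum_n M (K + d) - sum_n M K)%R.
Proof.
induction d as [|d IH]; intros H.
- rewrite Nat.add_0_r; replace (_ - _) with (RtoC 0) by ring; rewrite Cmod_0; lra.
- rewrite Nat.add_succ_r, Csum_S, sum_Sn.
  replace (_ - _) with (Csum u (K + d) - Csum u K + u (S (K + d))) by ring.
  eapply Rle_trans; [apply Cmod_triangle|].
  assert (H1 := IH ltac:(intros k Hk; apply H; lia)).
  assert (H2 := H (S (K + d)) ltac:(lia)).
  change (plus ?x ?y) with (x + y)%R; lra.
Qed.

Lemma tannery (f : nat -> nat -> C) (g : nat -> C) (M : nat -> R) (l : C) :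
  (forall N n, (n <= N)%nat -> Cmod (f N n) <= M n)%R -> ex_series M ->
  (forall n, Clim (fun N => f N n) (g n)) -> Clim (Csum g) l ->
  Clim (fun N => Csum (f N) N) l.
Proof.
intros Hf [S HS] Hg Hl.
assert (HM0 : forall n, (0 <= M n)%R)
  by (intros n; eapply Rle_trans; [apply Cmod_ge_0|apply (Hf n n (le_n n))]).
assert (HMS : forall N, (sum_n M N <= S)%R).
{ intros N; apply (is_lim_seq_incr_compare (sum_n M) S HS).
  intros n; rewrite sum_Sn; specialize (HM0 (Datatypes.S n)).
  change (plus ?x ?y) with (x + y)%R; lra. }
assert (Hhead : forall K,
  is_lim_seq (fun N => sum_n (fun n => Cmod (f N n - g n)) K) 0%R).
{ induction K as [|K IH].
  - apply is_lim_seq_ext with (fun N => Cmod (f N O - g O)); [|apply Hg].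
    intros N; now rewrite sum_O.
  - apply is_lim_seq_ext with (fun N =>
      sum_n (fun n => Cmod (f N n - g n)) K + Cmod (f N (Datatypes.S K) - g (Datatypes.S K)))%R.
    + intros N; now rewrite sum_Sn.
    + replace 0%R with (0 + 0)%R by ring; apply is_lim_seq_plus'; [exact IH|apply Hg]. }
(* An eps/3 argument: the cut K, independent of N, makes both the tail of M and the distance from
   [Csum g K] to l small; only then is N taken large enough for the head up to K. *)
unfold Clim; apply is_lim_seq_spec; intros eps.
assert (He : (0 < eps / 3)%R) by (pose proof (cond_pos eps); lra).
destruct (proj2 (is_lim_seq_spec _ _) Hl (mkposreal _ He)) as [K1 HK1].
destruct (proj2 (is_lim_seq_spec _ S) HS (mkposreal _ He)) as [K2 HK2].
set (K := max K1 K2).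
destruct (proj2 (is_lim_seq_spec _ _) (Hhead K) (mkposreal _ He)) as [N0 HN0].
exists (max N0 K); intros N HN.
assert (E1 := HK1 K ltac:(lia)); assert (E2 := HK2 K ltac:(lia)).
assert (E3 := HN0 N ltac:(lia)); simpl in E1, E2, E3.
rewrite Rminus_0_r in *.
apply Rabs_def2 in E1, E2, E3.
rewrite Rabs_pos_eq by apply Cmod_ge_0.
assert (E4 : (Cmod (Csum (f N) N - Csum (f N) K) <= S - sum_n M K)%R).
{ replace N with (K + (N - K))%nat at 2 by lia.
  eapply Rle_trans; [apply Cmod_Csum_tail_le with (M := M)|].
  - intros k Hk; apply Hf; lia.
  - specialize (HMS (K + (N - K))%nat); lra. }
assert (E5 : (Cmod (Csum (f N) K - Csum g K)
              <= sum_n (fun n => Cmod (f N n - g n)) K)%R).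
{ rewrite <- Csum_minus; apply Cmod_Csum_le; intros; lra. }
replace (Csum (f N) N - l)
  with (Csum (f N) N - Csum (f N) K + (Csum (f N) K - Csum g K) + (Csum g K - l)) by ring.
eapply Rle_lt_trans; [apply Cmod_triangle|].
eapply Rle_lt_trans; [apply Rplus_le_compat_r, Cmod_triangle|].
change (sum_n (G := R_AbelianMonoid) M K - S < eps / 3 /\
        - (eps / 3) < sum_n (G := R_AbelianMonoid) M K - S)%R in E2.
lra.
Qed.

(** * Uniform bounds on shifted factorials and on their reciprocals *)

Lemma qpoch_bounded (x p : C) : (Cmod p < 1)%R -> Cbounded (qpoch x p).
Proof.
intros Hp; exists (exp (Cmod x / (1 - Cmod p))); intros n.
eapply Rle_trans; [now apply Cmod_qpoch_le|].
assert (0 <= Cmod x / (1 - Cmod p))%R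
  by (apply Rdiv_le_0_compat; [apply Cmod_ge_0|lra]).
assert (0 <= Cmod p ^ n)%R by apply pow_le, Cmod_ge_0.
apply Rnot_lt_le; intros Hlt; apply exp_lt_inv in Hlt; nra.
Qed.

(* [1 / (1 - t) = 1 + t / (1 - t) <= exp (t / (1 - |x|))] for [0 <= t <= |x|]. *)
Lemma Cmod_qpoch_inv_le (x p : C) (n : nat) :
  (Cmod x < 1)%R -> (Cmod p < 1)%R ->
  (Cmod (/ qpoch x p n)
   <= exp (Cmod x / ((1 - Cmod x) * (1 - Cmod p)) * (1 - Cmod p ^ n)))%R.
Proof.
intros Hx Hp; induction n as [|n IH].
- simpl; rewrite Rminus_diag, Rmult_0_r, exp_0.
  rewrite Cmod_inv, Cmod_1 by exact C1_nz; lra.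
- assert (Hf : 1 - x * p ^ n <> 0) by now apply one_minus_neq0, Cmod_mult_pow_lt1.
  rewrite qpoch_S, Cinv_mult, Cmod_mult by (try apply qpoch_neq0; assumption).
  set (t := (Cmod x * Cmod p ^ n)%R).
  assert (Ht : (0 <= t <= Cmod x)%R).
  { pose proof (Cmod_ge_0 x); pose proof (Cmod_ge_0 p).
    assert (0 <= Cmod p ^ n <= 1)%R.
    { split; [now apply pow_le|rewrite <- (pow1 n); apply pow_incr; lra]. }
    unfold t; nra. }
  replace (_ * (1 - Cmod p ^ S n))%R
    with (Cmod x / ((1 - Cmod x) * (1 - Cmod p)) * (1 - Cmod p ^ n)
          + t / (1 - Cmod x))%R by (unfold t; simpl; field; lra).
  rewrite exp_plus.
  apply Rmult_le_compat; try apply Cmod_ge_0; [exact IH|].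
  apply Rle_trans with (1 + t / (1 - Cmod x))%R; [|apply exp_ineq1_le].
  rewrite Cmod_inv by exact Hf.
  assert (Hlow : (1 - t <= Cmod (1 - x * p ^ n))%R).
  { assert (H : (Cmod (1 - x * p ^ n + x * p ^ n) <= Cmod (1 - x * p ^ n) + Cmod (x * p ^ n))%R)
      by apply Cmod_triangle.
    replace (1 - x * p ^ n + x * p ^ n) with (RtoC 1) in H by ring.
    rewrite Cmod_1, Cmod_mult, Cmod_pow in H; fold t in H; lra. }
  apply Rle_trans with (/ (1 - t))%R; [apply Rinv_le_contravar; lra|].
  replace (/ (1 - t))%R with (1 + t / (1 - t))%R by (field; lra).
  apply Rplus_le_compat_l, Rmult_le_compat_l; [lra|].
  apply Rinv_le_contravar; lra.
Qed.

Lemma qpoch_inv_bounded (x p : C) :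
  (Cmod x < 1)%R -> (Cmod p < 1)%R -> Cbounded (fun n => / qpoch x p n).
Proof.
intros Hx Hp; exists (exp (Cmod x / ((1 - Cmod x) * (1 - Cmod p)))); intros n.
eapply Rle_trans; [now apply Cmod_qpoch_inv_le|].
assert (0 <= Cmod x / ((1 - Cmod x) * (1 - Cmod p)))%R.
{ apply Rdiv_le_0_compat; [apply Cmod_ge_0|apply Rmult_lt_0_compat; lra]. }
assert (0 <= Cmod p ^ n)%R by apply pow_le, Cmod_ge_0.
apply Rnot_lt_le; intros Hlt; apply exp_lt_inv in Hlt; nra.
Qed.

Lemma qpoch_inf_inv (x p : C) : (Cmod x < 1)%R -> (Cmod p < 1)%R ->
  qpoch_inf x p <> 0 /\ Clim (fun n => / qpoch x p n) (/ qpoch_inf x p).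
Proof.
intros Hx Hp; apply Clim_inv.
- intros n; now apply qpoch_neq0.
- now apply qpoch_inv_bounded.
- now apply Clim_filterlim, qpoch_inf_correct.
Qed.

Lemma ex_series_bounded_geom (K : R) (z : C) :
  (Cmod z < 1)%R -> ex_series (fun n => K * Cmod z ^ n)%R.
Proof.
intros Hz; apply (ex_series_scal (K := R_AbsRing) (V := R_NormedModule)), ex_series_geom.
now rewrite Rabs_pos_eq; [|apply Cmod_ge_0].
Qed.

Lemma Cmod_mult_geom_le (h : nat -> C) (z : C) (K : R) (n : nat) :
  (forall n, Cmod (h n) <= K)%R -> (Cmod (h n * z ^ n) <= K * Cmod z ^ n)%R.
Proof.
intros H; rewrite Cmod_mult, Cmod_pow.
apply Rmult_le_compat_r; [apply pow_le, Cmod_ge_0|apply H].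
Qed.

Lemma ex_series_Cbounded_geom (h : nat -> C) (z : C) :
  Cbounded h -> (Cmod z < 1)%R -> ex_series (fun n => h n * z ^ n).
Proof.
intros [K HK] Hz.
apply (ex_series_le (K := C_AbsRing) (V := C_CompleteNormedModule))
  with (fun n => K * Cmod z ^ n)%R; [|now apply ex_series_bounded_geom].
intros n; now apply Cmod_mult_geom_le.
Qed.

(** Serves both sides of the finite Bailey lemma: [c] collects the factorials that involve N, whose
    limit does not depend on n, and the majorant is K L |z|^n. *)
Lemma tannery_geom (h : nat -> C) (z : C) (c : nat -> nat -> C) (c0 l : C) :
  Cbounded h -> (Cmod z < 1)%R ->
  (exists L : R, forall N n, (Cmod (c N n) <= L)%R) ->
  (forall n, Clim (fun N => c N n) c0) ->
  is_series (fun n => h n * z ^ n) l ->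
  Clim (fun N => Csum (fun n => h n * z ^ n * c N n) N) (l * c0).
Proof.
intros [K HK] Hz [L HL] Hc Hl.
apply tannery with (g := fun n => h n * z ^ n * c0)
  (M := fun n => (K * L * Cmod z ^ n)%R).
- intros N n _; rewrite Cmod_mult.
  replace (K * L * Cmod z ^ n)%R with (K * Cmod z ^ n * L)%R by ring.
  apply Rmult_le_compat; auto using Cmod_ge_0, Cmod_mult_geom_le.
- now apply ex_series_bounded_geom.
- intros n; apply Clim_mult; [apply Clim_const|apply Hc].
- apply Clim_ext with (fun N => Csum (fun n => h n * z ^ n) N * c0).
  + intros N; rewrite Cmult_comm, <- Csum_mult_l; apply Csum_ext; intros; ring.
  + apply Clim_mult; [apply Clim_filterlim; exact Hl|apply Clim_const].
Qed.

(** * Boundedness of the inner Hecke sums *)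

(** Since 1 - x^n = (1 - x) (1 + x + ... + x^(n-1)), each of the n summands is at least x^n. *)
Lemma mult_pow_le (x : R) (n : nat) :
  (0 <= x <= 1)%R -> (INR n * x ^ n * (1 - x) <= 1 - x ^ n)%R.
Proof.
intros Hx; induction n as [|n IH]; [simpl; lra|].
rewrite S_INR; simpl pow.
assert (0 <= x ^ n <= 1)%R.
{ split; [now apply pow_le|rewrite <- (pow1 n); apply pow_incr; lra]. }
assert (x * (INR n * x ^ n * (1 - x)) <= x * (1 - x ^ n))%R
  by (apply Rmult_le_compat_l; lra).
assert (0 <= (1 - x) * (1 - x * x ^ n))%R by (apply Rmult_le_pos; nra).
nra.
Qed.

(** For |j| <= n the exponent is at least n^2 >= n, so the 2n + 1 terms add up to at most (2n + 1)
    |q|^n, and n |q|^n <= 1 / (1 - |q|). *)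
Lemma sum_sym_hecke_bounded (q : C) : (Cmod q < 1)%R ->
  Cbounded (fun n => sum_sym (fun j => q ^ Z.to_nat (2 * Z.of_nat n ^ 2 - j ^ 2)) n).
Proof.
intros Hq; exists (2 / (1 - Cmod q) + 1)%R; intros n.
assert (Hq0 := Cmod_ge_0 q).
assert (Hpow : forall m, (0 <= Cmod q ^ m <= 1)%R).
{ intros m; split; [now apply pow_le|rewrite <- (pow1 m); apply pow_incr; lra]. }
apply Rle_trans with (sum_n (fun _ => Cmod q ^ n)%R (2 * n)).
- apply Cmod_Csum_le; intros k Hk; rewrite Cmod_pow.
  set (j := (Z.of_nat k - Z.of_nat n)%Z).
  replace (Z.to_nat (2 * Z.of_nat n ^ 2 - j ^ 2))
    with (n + (Z.to_nat (2 * Z.of_nat n ^ 2 - j ^ 2) - n))%nat by (unfold j; nia).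
  rewrite pow_add; rewrite <- (Rmult_1_r (Cmod q ^ n)) at 2.
  apply Rmult_le_compat_l; apply Hpow.
- rewrite sum_n_const.
  replace (INR (S (2 * n))) with (2 * INR n + 1)%R by (rewrite S_INR, mult_INR; simpl; ring).
  assert (H := mult_pow_le (Cmod q) n ltac:(lra)); specialize (Hpow n).
  assert (INR n * Cmod q ^ n <= 1 / (1 - Cmod q))%R.
  { apply (Rmult_le_reg_r (1 - Cmod q)); [lra|].
    replace (1 / (1 - Cmod q) * (1 - Cmod q))%R with 1%R by (field; lra); lra. }
  replace (2 / (1 - Cmod q))%R with (2 * (1 / (1 - Cmod q)))%R by (field; lra).
  lra.
Qed.

(** * Letting N tend to infinity in the finite Bailey lemma *)

Theorem theorem3p12 (q a b : C)
  (hq0 : q <> 0) (ha0 : a <> 0) (hb0 : b <> 0)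
  (hq : (Cmod q < 1)%R)
  (hmax : (Rmax (Cmod (a * b))
             (Rmax (Cmod (a * q ^ 2)) (Cmod (b * q ^ 2))) < 1)%R) :
  ex_series
    (phi32_term (q ^ 2 / a) (q ^ 2 / b) (- q) q (- (q ^ 2)) (q ^ 2) (a * b)) /\
  ex_series (fun n => sum_sym (hecke_term q a b n) n) /\
  (qpoch_inf (q ^ 2) (q ^ 2) * qpoch_inf (a * b) (q ^ 2))
  / (qpoch_inf (a * q ^ 2) (q ^ 2) * qpoch_inf (b * q ^ 2) (q ^ 2))
  * phi32 (q ^ 2 / a) (q ^ 2 / b) (- q) q (- (q ^ 2)) (q ^ 2) (a * b)
  = CSeries (fun n => sum_sym (hecke_term q a b n) n).
Proof.
assert (Hab : (Cmod (a * b) < 1)%R)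
  by (eapply Rle_lt_trans; [apply Rmax_l|exact hmax]).
assert (Ha : (Cmod (a * q ^ 2) < 1)%R).
{ eapply Rle_lt_trans; [|exact hmax].
  eapply Rle_trans; [apply Rmax_l|apply Rmax_r]. }
assert (Hb : (Cmod (b * q ^ 2) < 1)%R).
{ eapply Rle_lt_trans; [|exact hmax].
  eapply Rle_trans; [apply Rmax_r|apply Rmax_r]. }
assert (Hp : (Cmod (q ^ 2) < 1)%R)
  by (rewrite Cmod_pow; pose proof (Cmod_ge_0 q); nra).
assert (Hmq : (Cmod (- q) < 1)%R) by now rewrite Cmod_opp.
assert (Hmp : (Cmod (- q ^ 2) < 1)%R) by now rewrite Cmod_opp.
set (p := q ^ 2) in *.
pose (beta := fun n => qpoch (- q) p n / (qpoch p p n * qpoch q p n * qpoch (- p) p n)).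
pose (S := fun n => sum_sym (fun j => q ^ Z.to_nat (2 * Z.of_nat n ^ 2 - j ^ 2)) n).
pose (alpha := fun n => (1 - q ^ (4 * n + 2)) * S n).
(* With (a b)^n split off, the coefficients of both series are bounded, so |a b| < 1 gives
   convergence and the geometric majorants. *)
pose (h1 := fun n => qpoch (p / a) p n * qpoch (p / b) p n * beta n).
pose (h2 := fun n => qpoch (p / a) p n * qpoch (p / b) p n
                     / (qpoch (a * p) p n * qpoch (b * p) p n) * alpha n).
assert (Hphi : forall n, h1 n * (a * b) ^ n
                 = phi32_term (p / a) (p / b) (- q) q (- p) p (a * b) n).
{ intros n; unfold h1, beta, phi32_term, Cdiv; ring. }
assert (Hhecke : forall n, h2 n * (a * b) ^ n = sum_sym (hecke_term q a b n) n).
{ intros n; unfold h2, alpha, S, hecke_term; fold p; rewrite sum_sym_mult_l; ring. }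
assert (Hh1 : Cbounded h1).
{ unfold h1, beta, Cdiv.
  apply Cbounded_ext with (fun n => qpoch (p / a) p n * qpoch (p / b) p n
    * (qpoch (- q) p n * (/ qpoch p p n * / qpoch q p n * / qpoch (- p) p n))).
  { intros n; unfold Cdiv; rewrite !Cinv_mult; try reflexivity;
      try apply Cmult_neq_0; now apply qpoch_neq0. }
  repeat apply Cbounded_mult;
    solve [now apply qpoch_bounded | now apply qpoch_inv_bounded]. }
assert (Hh2 : Cbounded h2).
{ unfold h2, alpha.
  apply Cbounded_ext with (fun n => qpoch (p / a) p n * qpoch (p / b) p n
    * (/ qpoch (a * p) p n * / qpoch (b * p) p n) * ((1 - q ^ (4 * n + 2)) * S n)).
  { intros n; unfold Cdiv; rewrite !Cinv_mult; try reflexivity; now apply qpoch_neq0. }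
  repeat apply Cbounded_mult;
    try solve [now apply qpoch_bounded | now apply qpoch_inv_bounded].
  - exists 2%R; intros n; unfold Cminus.
    eapply Rle_trans; [apply Cmod_triangle|].
    assert (H := Cmod_mult_pow_lt1 q q (4 * n + 1) hq hq).
    rewrite <- Cpow_S in H; replace (Datatypes.S (4 * n + 1)) with (4 * n + 2)%nat in H by lia.
    rewrite Cmod_1, Cmod_opp; lra.
  - now apply sum_sym_hecke_bounded. }
destruct (ex_series_Cbounded_geom h1 (a * b) Hh1 Hab : exists l : C, is_series _ l)
  as [l1 Hl1].
destruct (ex_series_Cbounded_geom h2 (a * b) Hh2 Hab : exists l : C, is_series _ l)
  as [l2 Hl2].
assert (Hs1 := is_series_ext _ _ _ Hphi Hl1).
assert (Hs2 := is_series_ext _ _ _ Hhecke Hl2).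
split; [now exists l1|split; [now exists l2|]].
unfold phi32; rewrite (CSeries_unique _ _ Hs1), (CSeries_unique _ _ Hs2).
destruct (qpoch_inf_inv p p Hp Hp) as [Np Lp].
destruct (qpoch_inf_inv (a * p) p Ha Hp) as [Na _].
destruct (qpoch_inf_inv (b * p) p Hb Hp) as [Nb _].
assert (Hlim : forall x, Clim (qpoch x p) (qpoch_inf x p))
  by (intros x; now apply Clim_filterlim, qpoch_inf_correct).
destruct (qpoch_bounded (a * b) p Hp) as [K1 HK1].
destruct (qpoch_inv_bounded p p Hp Hp) as [K2 HK2].
(* The Bailey parameters are x = p/a, y = p/b and z = a b, so x z = b p and y z = a p. For n > N the
   index N - n is 0, and the uniform bounds still hold. *)
assert (L1 := tannery_geom h1 (a * b)
  (fun N n => qpoch (a * b) p (N - n) * / qpoch p p (N - n))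
  (qpoch_inf (a * b) p * / qpoch_inf p p) l1 Hh1 Hab).
assert (L2 := tannery_geom h2 (a * b)
  (fun N n => / qpoch p p (N - n) * / qpoch p p (N + (n + 1)))
  (/ qpoch_inf p p * / qpoch_inf p p) l2 Hh2 Hab).
(* Both sides are limits of the same sequence, by the finite Bailey lemma for each N. *)
assert (E : l1 * (qpoch_inf (a * b) p * / qpoch_inf p p)
  = qpoch_inf (b * p) p * qpoch_inf (a * p) p
    * (l2 * (/ qpoch_inf p p * / qpoch_inf p p))).
{ refine (Clim_unique _ _ _ (L1 _ _ Hl1) _).
  - exists (K1 * K2)%R; intros N n; rewrite Cmod_mult.
    apply Rmult_le_compat; auto using Cmod_ge_0.
  - intros n; apply Clim_mult;
      [now apply Clim_shift_down
      |now apply Clim_shift_down with (u := fun n => / qpoch p p n)].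
  - refine (Clim_ext _ _ _ _
      (Clim_mult _ _ _ _ (Clim_mult _ _ _ _ (Hlim (b * p)) (Hlim (a * p)))
         (L2 _ _ Hl2))).
    + intros N; symmetry.
      replace (b * p) with (p / a * (a * b)) by (field; auto).
      replace (a * p) with (p / b * (a * b)) by (field; auto).
      etransitivity; [|etransitivity;
        [apply (bailey_lemma_finite (p / a) (p / b) (a * b) p alpha beta N)|]].
      * apply Csum_ext; intros n _; unfold h1, Cdiv; ring.
      * intros k; now apply qpoch_neq0.
      * replace (p / a * (a * b)) with (b * p) by (field; auto).
        intros k; now apply qpoch_neq0.
      * replace (p / b * (a * b)) with (a * p) by (field; auto).
        intros k; now apply qpoch_neq0.
      * simpl; field; auto.
      * intros n; now apply hecke_bailey_pair.
      * f_equal; apply Csum_ext; intros n _; unfold h2.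
        replace (p / a * (a * b)) with (b * p) by (field; auto).
        replace (p / b * (a * b)) with (a * p) by (field; auto).
        rewrite Nat.add_assoc; field; repeat split; now apply qpoch_neq0.
    + exists (K2 * K2)%R; intros N n; rewrite Cmod_mult.
      apply Rmult_le_compat; auto using Cmod_ge_0.
    + intros n; apply Clim_mult;
        [now apply Clim_shift_down with (u := fun n => / qpoch p p n)
        |now apply Clim_shift with (u := fun n => / qpoch p p n)]. }
(* Multiplying by (a p, b p;p)_inf / (p;p)_inf^2, which is nonzero, turns the goal into [E]. *)
apply (Cmult_eq_reg_l (qpoch_inf (b * p) p * qpoch_inf (a * p) p
                       * (/ qpoch_inf p p * / qpoch_inf p p))).
{ repeat apply Cmult_neq_0; auto using Cinv_neq0. }
transitivity (l1 * (qpoch_inf (a * b) p * / qpoch_inf p p)); [field; auto|].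
rewrite E; ring.
Qed.
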